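(* Let $(F,L,l)$ be an instance of the 2-ASLASAT problem and let $l^*$ be a neutral literal of $(F,L,l)$. Then there is a culprit set of $(F,L\cup\{l^*\},l)$ whose size is at most the size of a smallest culprit set of $(F,L,l)$.
   Context: A literal is a Boolean variable or its negation; $\neg$ denotes negation, and for a set $L$ of literals $\neg L=\{\neg l': l'\in L\}$. $Var(\cdot)$ denotes the set of variables. A 2-CNF formula $F$ is a conjunction of clauses each consisting of exactly two literals (a one-literal clause $(l)$ is written $(l\vee l)$; $(l_1\vee l_2)$ and $(l_2\vee l_1)$ are the same clause), with pairwise distinct clauses; $Clauses(F)$ is its set of clauses and $F\setminus S$ is the formula of clauses of $F$ not in $S$. A set of literals is non-contradictory if it contains no literal and its negation. A satisfying assignment of $F$ is a non-contradictory set $P$ of literals with $Var(P)=Var(F)$ such that each clause of $F$ contains a literal of $P$. $SWRT(F,L)$ means $F$ has a satisfying assignment $P$ with $P\cap \neg L=\emptyset$. An instance of the 2-ASLASAT problem is a triple $(F,L,l)$ with $F$ such a 2-CNF formula, $L$ a non-contradictory set of literals with $SWRT(F,L)$ true, and $l$ a literal with $Var(l)\notin Var(L)$. A culprit set of $(F,L,l)$ is $S\subseteq Clauses(F)$ with $SWRT(F\setminus S,L\cup\{l\})$ true. A walk of $F$ is a nonempty sequence $(C_1,\dots,C_q)$ of (not necessarily distinct) clauses of $F$ where in each entry one literal is designated first and the other second, such that for $i<q$ the second literal of $C_i$ is the negation of the first literal of $C_{i+1}$; it is from the first literal of $C_1$ to the second literal of $C_q$, and from a set $M$ if its first literal lies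 in $M$. A path is a walk whose clauses are pairwise distinct. For a set $M$ of literals and a literal $l_y$, $SepSize(F,M,l_y)$ is the minimum size of a set $SC$ of clauses of $F$ such that $F\setminus SC$ has no path from $M$ to $l_y$. A literal $l^*$ is a neutral literal of $(F,L,l)$ if $(F,L\cup\{l^*\},l)$ is an instance of the 2-ASLASAT problem and $SepSize(F,\neg L,\neg l)=SepSize(F,\neg(L\cup\{l^*\}),\neg l)$. *)

(* Defs.v *)
From HB Require Import structures.
From mathcomp Require Import all_boot.
From mathcomp Require Import boolp.

Set Implicit Arguments.
Unset Strict Implicit.
Unset Printing Implicit Defensive.

Section TwoASLASAT.

Variable V : finType.

(* (v, true) is the variable v, (v, false) its negation. *)
Definition lit : finType := (V * bool)%type.

Definition neg (x : lit) : lit := (x.1, ~~ x.2).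

Definition neg_set (L : {set lit}) : {set lit} := [set neg x | x in L].

Definition vars (L : {set lit}) : {set V} := [set x.1 | x in L].

Definition non_contradictory (L : {set lit}) : bool :=
  [forall x in L, neg x \notin L].

(* The clause (l1 \/ l2) is the set {l1, l2}: this identifies it with          *)
(* (l2 \/ l1), and (l \/ l) is the singleton {l}. A formula is the set of its  *)
(* clauses, so that Clauses(F) is F and removing clauses is set difference.    *)
Definition clause : finType := {set lit}.

Definition formula : finType := {set clause}.

Definition two_cnf (F : formula) : Prop :=
  forall C : clause, C \in F -> exists l1 l2 : lit, C = [set l1; l2].

Definition formula_vars (F : formula) : {set V} := vars (cover F).

Definition satisfying_assignment (F : formula) (P : {set lit}) : bool :=
  [&& non_contradictory P,
      vars P == formula_vars F
    & [forall C in F, [exists x in C, x \in P]]].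

Definition SWRT (F : formula) (L : {set lit}) : bool :=
  [exists P : {set lit},
     satisfying_assignment F P && (P :&: neg_set L == set0)].

Record instance (F : formula) (L : {set lit}) (l : lit) : Prop := Instance {
  instance_two_cnf : two_cnf F;
  instance_non_contradictory : non_contradictory L;
  instance_SWRT : SWRT F L;
  instance_var : l.1 \notin vars L
}.

Definition culprit_set (F : formula) (L : {set lit}) (l : lit) (S : formula) :
    bool :=
  (S \subset F) && SWRT (F :\: S) (L :|: [set l]).

Definition smallest_culprit_set (F : formula) (L : {set lit}) (l : lit)
    (S : formula) : Prop :=
  culprit_set F L l S /\
  forall S' : formula, culprit_set F L l S' -> #|S| <= #|S'|.

(* An entry of a walk is a clause together with the choice of its first and    *)
(* second literal, that is, an ordered pair of literals.                       *)
Definition entry : finType := (lit * lit)%type.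

Definition entry_clause (e : entry) : clause := [set e.1; e.2].

Definition walk (F : formula) (w : seq entry) : bool :=
  [&& w != [::],
      all (fun e => entry_clause e \in F) w
    & sorted (fun e1 e2 : entry => e1.2 == neg e2.1) w].

Definition simple_path (F : formula) (w : seq entry) : bool :=
  walk F w && uniq [seq entry_clause e | e <- w].

Definition has_path (F : formula) (M : {set lit}) (ly : lit) : Prop :=
  exists (e : entry) (w : seq entry),
    [/\ simple_path F (e :: w), e.1 \in M & (last e w).2 = ly].

Definition separator (F : formula) (M : {set lit}) (ly : lit) (SC : formula) :
    bool :=
  (SC \subset F) && ~~ `[< has_path (F :\: SC) M ly >].

(* F is itself a separator, hence a legitimate starting point for arg min.     *)
Definition SepSize (F : formula) (M : {set lit}) (ly : lit) : nat :=
  #|[arg min_(SC < F | separator F M ly SC) #|SC|]|.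

Definition neutral_literal (F : formula) (L : {set lit}) (l ls : lit) : Prop :=
  instance F (L :|: [set ls]) l /\
  SepSize F (neg_set L) (neg l) =
    SepSize F (neg_set (L :|: [set ls])) (neg l).

Lemma separator_full (F : formula) (M : {set lit}) (ly : lit) :
  separator F M ly F.
Proof.
rewrite /separator subxx /=; apply/asboolPn => -[e [w [/andP[/and3P[_ + _] _] _ _]]].
by rewrite setDv /= inE.
Qed.

Lemma SepSizeP (F : formula) (M : {set lit}) (ly : lit) :
  (exists2 SC : formula, separator F M ly SC & #|SC| = SepSize F M ly) /\
  (forall SC : formula, separator F M ly SC -> SepSize F M ly <= #|SC|).
Proof.
rewrite /SepSize; case: arg_minnP; first exact: separator_full.
by move=> SC sepSC minSC; split; first exists SC.
Qed.

Lemma culprit_set_full (F : formula) (L : {set lit}) (l : lit) :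
  culprit_set F L l F.
Proof.
rewrite /culprit_set subxx setDv; apply/existsP; exists set0.
rewrite set0I eqxx andbT; apply/and3P; split.
- by apply/forall_inP => x; rewrite inE.
- by rewrite /formula_vars /vars /cover big_set0.
- by apply/forall_inP => C; rewrite inE.
Qed.

Lemma smallest_culprit_set_exists (F : formula) (L : {set lit}) (l : lit) :
  exists S : formula, smallest_culprit_set F L l S.
Proof.
case: (@arg_minnP _ F (culprit_set F L l) (fun S : formula => #|S|)).
  exact: culprit_set_full.
by move=> S culS minS; exists S.
Qed.

End TwoASLASAT.

(* Main.v *)
Require Import Defs.
From HB Require Import structures.
From mathcomp Require Import all_boot.
From mathcomp Require Import boolp.

(** A clause (a \/ b) is read as the two implications ~a -> b and ~b -> a, so
    that a path from ~L to ~l is a chain of implications from L to ~l.  Read a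
    set A of literals as a partial assignment, and call boundary of A the set of
    the clauses with a literal that A makes false but none that A makes true:
    these are the clauses whose implications leave A.  Boundaries and separators
    correspond, so SepSize(F, ~L, ~l) is the least size of the boundary of a
    consistent set that contains L and avoids ~l.  Let A be such an optimal set
    for L + l*; neutrality says that it is still optimal for L.
    Given a total assignment P extending L + l, let P' agree with A on the
    variables of A and with P elsewhere.  Then

      #falsified(P') + #boundary(A & P) <= #falsified(P) + #boundary(A),

    and the boundary of A & P is at least as large as that of A, so P' falsifies
    no more clauses than P.  The clauses falsified by P' are the culprit set. *)

Set Implicit Arguments.
Unset Strict Implicit.
Unset Printing Implicit Defensive.

Section TwoCNF.

Variable V : finType.
Implicit Types (x y : lit V) (p : seq (lit V)) (A B L P T : {set lit V}).
Implicit Types (e f : entry V) (w : seq (entry V)).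
Implicit Types (C : clause V) (F S : formula V).

Lemma negK : involutive (@neg V).
Proof. by case=> v b; rewrite /neg /= negbK. Qed.

Lemma eq_var x y : (x.1 == y.1) = (x == y) || (x == neg y).
Proof.
case: x y => [v b] [w c]; rewrite !xpair_eqE.
by case: (v == w); case: b c => [] [].
Qed.

Lemma mem_neg_set L x : (x \in neg_set L) = (neg x \in L).
Proof. by rewrite -{1}(negK x) mem_imset //; exact: inv_inj negK. Qed.

Lemma mem_vars L x : (x.1 \in vars L) = (x \in L) || (neg x \in L).
Proof.
apply/imsetP/orP => [[y yL /eqP]|[xL|nxL]]; last 2 first.
- by exists x.
- by exists (neg x).
by rewrite eq_var => /orP[]/eqP->; [left | right; rewrite negK].
Qed.

Lemma non_contradictoryS A B :
  A \subset B -> non_contradictory B -> non_contradictory A.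
Proof.
move=> /subsetP AB /forall_inP ncB; apply/forall_inP => x xA.
by apply: contra (ncB x (AB x xA)); apply: AB.
Qed.

Lemma non_contradictoryU A B : non_contradictory A -> non_contradictory B ->
  A :&: neg_set B = set0 -> non_contradictory (A :|: B).
Proof.
move=> /forall_inP ncA /forall_inP ncB /setP AB; apply/forall_inP => x.
have := AB x; have := AB (neg x); rewrite !inE !mem_neg_set negK negb_or.
move=> ABnx ABx /orP[xA|xB].
  by rewrite xA /= in ABx; rewrite ncA // ABx.
by rewrite xB andbT in ABnx; rewrite ncB // ABnx.
Qed.

Lemma non_contradictoryU1 L x :
  non_contradictory L -> x.1 \notin vars L -> non_contradictory (L :|: [set x]).
Proof.
rewrite mem_vars negb_or => ncL /andP[_ nxL]; apply: non_contradictoryU => //.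
  by apply/forall_inP => y /set1P->; rewrite inE -pair_eqE /= eqxx; case: x.2.
apply/eqP; rewrite -subset0; apply/subsetP => y /setIP[yL].
by rewrite mem_neg_set inE => /eqP nyx; rewrite -nyx negK yL in nxL.
Qed.

Definition total_assignment T : Prop :=
  forall x, (neg x \in T) = (x \notin T).

Lemma total_non_contradictory T : total_assignment T -> non_contradictory T.
Proof. by move=> totT; apply/forall_inP => x; rewrite totT negbK. Qed.

Definition override A P : {set lit V} := A :|: (P :\: neg_set A).

Lemma total_override A P :
  non_contradictory A -> total_assignment P -> total_assignment (override A P).
Proof.
move=> /forall_inP ncA totP x; have := ncA x.
rewrite !inE !mem_neg_set negK totP.
by case: (x \in A); case: (neg x \in A); case: (x \in P) => // /(_ isT).
Qed.

Lemma total_extension A :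
  non_contradictory A -> exists2 T, total_assignment T & A \subset T.
Proof.
move=> ncA; exists (override A [set x | x.2]); last exact: subsetUl.
by apply: total_override => // x; rewrite !inE.
Qed.

Definition falsified F A : formula V := [set C in F | C \subset neg_set A].

Lemma falsifiedS F A B : A \subset B -> falsified F A \subset falsified F B.
Proof.
move=> AB; apply/subsetP => C; rewrite !inE => /andP[-> /subset_trans]; apply.
exact: imsetS.
Qed.

Lemma falsifiedD F S A : falsified (F :\: S) A = falsified F A :\: S.
Proof. by apply/setP => C; rewrite !inE andbA. Qed.

Lemma total_satisfying_assignment F T :
  total_assignment T -> falsified F T = set0 ->
  satisfying_assignment F [set x in T | x.1 \in formula_vars F].
Proof.
move=> totT F0; apply/and3P; split.
- apply: non_contradictoryS (total_non_contradictory totT).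
  by apply/subsetP => x; rewrite inE => /andP[].
- apply/eqP/setP => v; apply/imsetP/idP => [[x + ->]|vF].
    by rewrite inE => /andP[].
  have : (v, true) \in T \/ (v, false) \in T.
    by apply/orP; rewrite -[(v, false)]/(neg (v, true)) totT orbN.
  by case=> vT; [exists (v, true) | exists (v, false)]; rewrite ?inE ?vT.
- apply/forall_inP => C CF; apply: contraT => /exists_inPn noC.
  suff : C \in falsified F T by rewrite F0 inE.
  rewrite inE CF; apply/subsetP => x xC; rewrite mem_neg_set totT.
  apply: contra (noC x xC) => xT; rewrite inE xT.
  by apply/imsetP; exists x => //; apply/bigcupP; exists C.
Qed.

Lemma SWRTP F L : non_contradictory L ->
  reflect (exists T,
             [/\ total_assignment T, L \subset T & falsified F T = set0])
          (SWRT F L).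
Proof.
move=> ncL; apply: (iffP existsP) => [[P]|[T [totT /subsetP LT F0]]].
  case/andP=> /and3P[ncP _ /forall_inP satP] /eqP PL.
  have [T totT] := total_extension (non_contradictoryU ncP ncL PL).
  rewrite subUset => /andP[/subsetP PT LT]; exists T; split=> //.
  apply/eqP; rewrite -subset0; apply/subsetP => C.
  rewrite inE => /andP[CF /subsetP CT].
  have /exists_inP[x /CT + /PT xT] := satP C CF.
  by rewrite mem_neg_set totT xT.
exists [set x in T | x.1 \in formula_vars F].
rewrite total_satisfying_assignment //=.
apply/eqP/setP => x; rewrite !inE mem_neg_set; apply/negP.
by case/andP => /andP[xT _] /LT; rewrite totT xT.
Qed.

Lemma culprit_set_total F L l S : non_contradictory (L :|: [set l]) ->
  culprit_set F L l S ->
  exists T, [/\ total_assignment T, L :|: [set l] \subset T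
              & falsified F T \subset S].
Proof.
move=> ncLl /andP[_ /(SWRTP _ ncLl)[T [totT LlT]]].
by rewrite falsifiedD => /eqP; rewrite setD_eq0; exists T.
Qed.

Lemma culprit_set_falsified F L l T : total_assignment T ->
  L :|: [set l] \subset T -> culprit_set F L l (falsified F T).
Proof.
move=> totT LlT; apply/andP; split.
  by apply/subsetP => C; rewrite inE => /andP[].
apply/SWRTP; first exact: non_contradictoryS LlT (total_non_contradictory totT).
by exists T; split; rewrite // falsifiedD setDv.
Qed.

Definition implies F : rel (lit V) := fun x y => [set neg x; y] \in F.

Definition implication_closed F A : Prop :=
  forall x y, implies F x y -> x \in A -> y \in A.

Definition implied F L : {set lit V} :=
  [set y | [exists x in L, connect (implies F) x y]].

Lemma sub_implied F L : L \subset implied F L.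
Proof. by apply/subsetP => x xL; rewrite inE; apply/exists_inP; exists x. Qed.

Lemma implied_closed F L : implication_closed F (implied F L).
Proof.
move=> x y xy; rewrite !inE => /exists_inP[z zL zx].
apply/exists_inP; exists z => //.
exact: connect_trans zx (connect1 xy).
Qed.

Lemma implied_sub F L A :
  implication_closed F A -> L \subset A -> implied F L \subset A.
Proof.
move=> clA /subsetP LA; apply/subsetP => y; rewrite inE.
case/exists_inP=> x /LA xA /connectP[p xp ->].
by elim: p x xA xp => //= z p IH x xA /andP[/clA/(_ xA)/IH].
Qed.

Lemma model_closed F T : total_assignment T -> falsified F T = set0 ->
  implication_closed F T.
Proof.
move=> totT F0 x y xy xT; apply: contraT => yT.
suff : [set neg x; y] \in falsified F T by rewrite F0 inE.
by rewrite inE [_ \in F]xy subUset !sub1set !mem_neg_set negK xT totT.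
Qed.

Lemma path_of_walk F e w :
  walk F (e :: w) -> path (implies F) (neg e.1) (unzip2 (e :: w)).
Proof.
rewrite /walk /=; elim: w e => [|f w IH] e /=.
  by rewrite /implies negK !andbT.
case/andP=> /andP[eF /andP[fF wF]] /andP[/eqP ef fw].
by rewrite {1}/implies negK [_ \in F]eF ef; apply: IH; rewrite fF wF.
Qed.

Lemma has_path_implied F L y : has_path F (neg_set L) y -> y \in implied F L.
Proof.
case=> e [w [/andP[/path_of_walk ew _] + <-]]; rewrite mem_neg_set inE => neL.
apply/exists_inP; exists (neg e.1) => //; apply/connectP.
by exists (unzip2 (e :: w)); rewrite //= last_map.
Qed.

Definition walk_of x p : seq (entry V) :=
  pairmap (fun y z => (neg y, z)) x p.

Lemma unzip1_walk_of x p : unzip1 (walk_of x p) = [seq neg y | y <- belast x p].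
Proof. by elim: p x => //= y p IH x; rewrite IH. Qed.

Lemma unzip2_walk_of x p : unzip2 (walk_of x p) = p.
Proof. by elim: p x => //= y p IH x; rewrite IH. Qed.

Lemma walk_of_path F x y p :
  path (implies F) x (y :: p) -> walk F (walk_of x (y :: p)).
Proof.
rewrite /walk; elim: p x y => [|z p IH] x y /=.
  by rewrite /implies !andbT.
by case/andP=> xy /(IH y z) /= /andP[-> ->]; rewrite negK eqxx [_ \in F]xy.
Qed.

Lemma entry_clause_inj A : non_contradictory A ->
  {in [pred e : entry V | (neg e.1 \in A) && (e.2 \in A)] &,
     injective (@entry_clause V)}.
Proof.
move=> /forall_inP ncA [a b] [c d]; rewrite !inE /=.
case/andP=> naA bA /andP[ncinA dA].
move/setP=> eq_abcd; have := eq_abcd a; have := eq_abcd b.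
rewrite !inE !eqxx orbT /= => /esym/orP[/eqP bc|/eqP->].
  by move: (ncA b bA); rewrite bc ncinA.
case/esym/orP=> /eqP ad; first by rewrite ad.
by move: (ncA d dA); rewrite -ad naA.
Qed.

(* A walk may traverse a clause once in each direction, so that without the
   consistency hypothesis it cannot always be shortened to a path. *)
Lemma uniq_walk_of x p : non_contradictory [set y in x :: p] -> uniq (x :: p) ->
  uniq [seq entry_clause e | e <- walk_of x p].
Proof.
move=> ncp up; rewrite map_inj_in_uniq.
  apply: (@map_uniq _ _ fst); rewrite -/(unzip1 _) unzip1_walk_of.
  rewrite (map_inj_uniq (inv_inj negK)).
  by move: up; rewrite lastI rcons_uniq => /andP[].
have inp e : e \in walk_of x p ->
    (neg e.1 \in [set y in x :: p]) && (e.2 \in [set y in x :: p]).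
  move=> ew; rewrite !in_set; apply/andP; split.
    have : e.1 \in unzip1 (walk_of x p) by apply: map_f.
    by rewrite unzip1_walk_of => /mapP[y /mem_belast yp ->]; rewrite negK.
  have : e.2 \in unzip2 (walk_of x p) by apply: map_f.
  by rewrite unzip2_walk_of in_cons => ->; rewrite orbT.
by move=> e f ew fw; apply: (entry_clause_inj ncp); apply: inp.
Qed.

Lemma implied_has_path F L y : non_contradictory (implied F L) ->
  y \in implied F L -> y \notin L -> has_path F (neg_set L) y.
Proof.
move=> ncA + yL; rewrite inE => /exists_inP[x xL /connectP[p0 xp0 y_last]].
case: (shortenP xp0) y_last => p xp up _ y_last.
have ncp : non_contradictory [set z in x :: p].
  apply: non_contradictoryS ncA; apply/subsetP => z; rewrite inE => zp.
  by rewrite inE; apply/exists_inP; exists x; rewrite // (path_connect xp).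
case: p => [|z p] /= in xp up y_last ncp *; first by rewrite y_last xL in yL.
exists (neg x, z), (walk_of z p); split.
- by apply/andP; split; [apply: walk_of_path xp | apply: uniq_walk_of ncp up].
- by rewrite mem_neg_set negK.
- by rewrite -last_map -/(unzip2 _) unzip2_walk_of.
Qed.

Definition boundary F A : formula V :=
  [set C in F | [disjoint C & A] && ~~ [disjoint C & neg_set A]].

Lemma boundaryP F A C :
  reflect [/\ C \in F, {in C, forall x, x \notin A}
             & exists2 x, x \in C & neg x \in A]
          (C \in boundary F A).
Proof.
rewrite inE disjoint_subset; apply: (iffP and3P) => -[CF CA CnA]; split=> //.
- exact: (subsetP CA).
- by case/pred0Pn: CnA => x /andP[/= xC]; rewrite mem_neg_set; exists x.
- exact/subsetP.
- by case: CnA => x xC nxA; apply/pred0Pn; exists x; rewrite /= xC mem_neg_set.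
Qed.

Lemma closed_off_boundary F A :
  non_contradictory A -> implication_closed (F :\: boundary F A) A.
Proof.
move=> /forall_inP ncA x y; rewrite /implies inE => /andP[+ xyF] xA.
apply: contraR => yA; apply/boundaryP; split=> //.
  by move=> z /set2P[]->; rewrite ?ncA.
by exists (neg x); rewrite ?negK // !inE eqxx.
Qed.

Lemma two_cnf_other F C x :
  two_cnf F -> C \in F -> x \in C -> exists y, C = [set x; y].
Proof.
move=> cnfF /cnfF[a [b ->]] /set2P[]->; first by exists b.
by exists a; rewrite setUC.
Qed.

Lemma closed_boundary_sub F S A :
  two_cnf F -> implication_closed (F :\: S) A -> boundary F A \subset S.
Proof.
move=> cnfF clA; apply/subsetP => C /boundaryP[CF CA [x xC nxA]].
apply: contraT => CS; have [y eqC] := two_cnf_other cnfF CF xC.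
have yC : y \in C by rewrite eqC !inE eqxx orbT.
rewrite -(negbTE (CA y yC)); apply: clA nxA.
by rewrite /implies negK -eqC inE CS.
Qed.

Lemma boundary_separator F L A y : non_contradictory A -> L \subset A ->
  y \notin A -> separator F (neg_set L) y (boundary F A).
Proof.
move=> ncA LA yA; apply/andP; split.
  by apply/subsetP => C /boundaryP[].
apply/asboolPn => /has_path_implied yL; case/negP: yA.
exact: (subsetP (implied_sub (closed_off_boundary ncA) LA)) yL.
Qed.

Lemma SepSize_leq_boundary F L A y : non_contradictory A -> L \subset A ->
  y \notin A -> SepSize F (neg_set L) y <= #|boundary F A|.
Proof.
move=> ncA LA yA; have [_ minSep] := SepSizeP F (neg_set L) y.
exact/minSep/boundary_separator.
Qed.

Lemma SepSize_eq_boundary F L y :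
  two_cnf F -> non_contradictory L -> SWRT F L -> y \notin L ->
  exists A, [/\ L \subset A, y \notin A, non_contradictory A,
                falsified F A = set0
              & #|boundary F A| = SepSize F (neg_set L) y].
Proof.
move=> cnfF ncL /(SWRTP _ ncL)[T [totT LT F0]] yL.
have [[S sepS cardS] _] := SepSizeP F (neg_set L) y.
pose A := implied (F :\: S) L.
have LA : L \subset A by exact: sub_implied.
have AT : A \subset T.
  by apply: implied_sub LT; apply: model_closed; rewrite // falsifiedD F0 set0D.
have ncA : non_contradictory A.
  exact: non_contradictoryS AT (total_non_contradictory totT).
have yA : y \notin A.
  case/andP: sepS => _ /asboolPn noPath; apply/negP => yA.
  exact: noPath (implied_has_path ncA yA yL).
exists A; split=> //; first by apply/eqP; rewrite -subset0 -F0 falsifiedS.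
apply/eqP; rewrite eqn_leq SepSize_leq_boundary // andbT -cardS.
exact: subset_leq_card (closed_boundary_sub cnfF (@implied_closed _ _)).
Qed.

Lemma falsified_override_sub F A P : non_contradictory A ->
  falsified F (override A P) \subset falsified F P :|: boundary F A.
Proof.
move=> /forall_inP ncA; apply/subsetP => C.
rewrite inE => /andP[CF /subsetP CQ].
have CAP x : x \in C -> x \notin A /\ (neg x \in A \/ neg x \in P).
  move/CQ; rewrite mem_neg_set !inE mem_neg_set negK.
  case/orP=> [nxA|/andP[xA nxP]]; last by split; last right.
  by split; [apply: contraL nxA; apply: ncA | left].
have [CnA|] := boolP [disjoint C & neg_set A].
  apply/setUP; left; rewrite inE CF; apply/subsetP => x xC.
  rewrite mem_neg_set; have [_ []//] := CAP x xC.
  by have := disjointFr CnA xC; rewrite mem_neg_set => ->.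
case/pred0Pn=> x /andP[/= xC nxA]; apply/setUP; right.
apply/boundaryP; split=> // [z /CAP[] //|].
by exists x; rewrite // -mem_neg_set.
Qed.

Lemma boundaryI_sub F A P :
  two_cnf F -> non_contradictory A -> total_assignment P ->
  boundary F (A :&: P) \subset falsified F P :|: boundary F A.
Proof.
move=> cnfF /forall_inP ncA totP; apply/subsetP => C /boundaryP[CF CAP [x xC]].
case/setIP=> nxA nxP; have [CA|] := boolP [disjoint C & A].
  apply/setUP; right; apply/boundaryP; split=> //; last by exists x.
  by move=> z /(disjointFr CA) ->.
case/pred0Pn=> y /andP[/= yC yA].
have nyP : neg y \in P by have := CAP y yC; rewrite inE yA totP.
have [z eqC] := two_cnf_other cnfF CF xC.
have yz : y = z.
  by move: yC; rewrite eqC => /set2P[] // yx; have := ncA y yA; rewrite yx nxA.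
apply/setUP; left.
by rewrite inE CF eqC -yz subUset !sub1set !mem_neg_set nxP nyP.
Qed.

Lemma falsified_override_boundaryI_sub F A P :
  two_cnf F -> non_contradictory A -> falsified F A = set0 ->
  falsified F (override A P) :&: boundary F (A :&: P)
    \subset falsified F P :&: boundary F A.
Proof.
move=> cnfF /forall_inP ncA F0; apply/subsetP => C /setIP[].
rewrite inE => /andP[CF /subsetP CQ] /boundaryP[_ _ [x xC /setIP[nxA nxP]]].
have [y eqC] := two_cnf_other cnfF CF xC.
apply/setIP; split; last first.
  apply/boundaryP; split=> //; last by exists x.
  move=> z /CQ; rewrite mem_neg_set !inE mem_neg_set negK.
  by case/orP=> [|/andP[]//]; apply: contraL; apply: ncA.
rewrite inE CF eqC subUset !sub1set !mem_neg_set nxP /=.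
have : y \in neg_set (override A P) by apply: CQ; rewrite eqC !inE eqxx orbT.
rewrite mem_neg_set inE => /orP[nyA|/setDP[]//].
suff : C \in falsified F A by rewrite F0 inE.
by rewrite inE CF eqC subUset !sub1set !mem_neg_set nxA nyA.
Qed.

Lemma override_submodular F A P :
  two_cnf F -> non_contradictory A -> falsified F A = set0 ->
  total_assignment P ->
  #|falsified F (override A P)| + #|boundary F (A :&: P)| <=
  #|falsified F P| + #|boundary F A|.
Proof.
move=> cnfF ncA F0 totP; rewrite -[leqLHS]cardsUI -[leqRHS]cardsUI.
apply: leq_add; apply: subset_leq_card.
  by rewrite subUset falsified_override_sub // boundaryI_sub.
exact: falsified_override_boundaryI_sub.
Qed.

End TwoCNF.

Theorem theorem3 (V : finType) (F : formula V) (L : {set lit V}) (l ls : lit V)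
  (hI : instance F L l) (hN : neutral_literal F L l ls) :
  exists S' : formula V,
    culprit_set F (L :|: [set ls]) l S' /\
    (forall S : formula V, smallest_culprit_set F L l S -> #|S'| <= #|S|).
Proof.
have [[cnfF ncL _ lL] [[_ ncM swM lM] neutral]] := (hI, hN).
have [S [culS minS]] := smallest_culprit_set_exists F L l.
have ncLl := non_contradictoryU1 ncL lL.
have [P [totP LlP falsP]] := culprit_set_total ncLl culS.
have [LP lP] : L \subset P /\ l \in P.
  by move: LlP; rewrite subUset sub1set => /andP.
have nlM : neg l \notin L :|: [set ls].
  by move: lM; rewrite mem_vars negb_or => /andP[].
have [A [MA nlA ncA F0 cardA]] := SepSize_eq_boundary cnfF ncM swM nlM.
have optA : #|boundary F A| <= #|boundary F (A :&: P)|.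
  rewrite cardA -neutral; apply: SepSize_leq_boundary.
  - exact: non_contradictoryS (subsetIl _ _) ncA.
  - by rewrite subsetI LP (subset_trans (subsetUl _ _) MA).
  - by rewrite inE (negbTE nlA).
exists (falsified F (override A P)); split.
  apply: culprit_set_falsified; first exact: total_override.
  by rewrite setUSS // sub1set inE mem_neg_set nlA.
move=> S0 [culS0 _]; apply: leq_trans (minS _ culS0).
apply: leq_trans (subset_leq_card falsP).
have := override_submodular cnfF ncA F0 totP.
by move/leq_trans/(_ (leq_add (leqnn _) optA)); rewrite leq_add2r.
Qed.
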